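(* Let $T$ be an o-minimal theory in a language including an order $<$, let $M$ be a model of $T$, let $x$ be a single variable, and put $X=S_x(M)$, $G=\mathrm{Aut}(M)$. Let $f\in E(X,G)$. Then $(X)^1_{f,W}$ is finite for every $W\in\mathcal U$, where $\mathcal U$ is the unique compatible uniformity of $X$. In particular $\beta(f)\leqslant 1$ and $\beta(X,G)\leqslant 1$.
   Context: A theory $T$ is o-minimal if in each of its models $M$ every subset of $M$ definable with parameters is a finite union of points and intervals with endpoints in $M\cup\{\pm\infty\}$. For a model $M$, $S_x(M)$ is the Stone space of complete types over $M$ in the variable(s) $x$, and $\mathrm{Aut}(M)$ (with the topology of pointwise convergence) acts on it by $\varphi(x,g(b))\in g\cdot p\iff\varphi(x,b)\in p$. A dynamical system $(X,G)$ is a compact Hausdorff space $X$ with a topological group $G$ acting continuously on $X$ by homeomorphisms; $(S_x(M),\mathrm{Aut}(M))$ is one. $\mathcal U$ denotes the unique compatible uniformity of $X$, i.e. the set of all neighbourhoods of the diagonal in $X\times X$. The Ellis semigroup $E(X,G)$ is the closure of $\{x\mapsto gx: g\in G\}$ in $X^X$ with the product (pointwise convergence) topology. For $Y\subseteq X$ closed, $f:Y\to X$ (for maps with larger domain use the restriction) and $W\in\mathcal U$, let $(Y)'_{f,W}$ be the set of $y\in Y$ such that for every open neighbourhood $V$ of $y$ in $Y$ there are $v_1,v_2\in V$ with $(f(v_1),f(v_2))\notin W$; this is a closed set. Put $(Y)^0_{f,W}=Y$, $(Y)^{\alpha+1}_{f,W}=((Y)^{\alpha}_{f,W})'_{f,W}$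 (so $(Y)^1_{f,W}=(Y)'_{f,W}$) and $(Y)^{\gamma}_{f,W}=\bigcap_{\alpha<\gamma}(Y)^{\alpha}_{f,W}$ for limit ordinals $\gamma$. Then $\beta(f,W)=\sup\{\alpha\in\mathrm{Ord}: (Y)^\alpha_{f,W}\neq\emptyset\}$, and $\beta(f,W)=\infty$ if $(Y)^\alpha_{f,W}\ne\emptyset$ for all ordinals $\alpha$. For $f:X\to X$, $\beta(f)=\sup_{W\in\mathcal U}\beta(f,W)$; and $\beta(X,G)=\sup_{f\in E(X,G)}\beta(f)$. *)

(* Defs.v *)
From HB Require Import structures.
From mathcomp Require Import all_boot.
From mathcomp Require Import all_classical.
From mathcomp Require Import topology.

Set Implicit Arguments.
Unset Strict Implicit.
Unset Printing Implicit Defensive.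

Local Open Scope classical_set_scope.

Record language := Language {
  fun_symb : Type;
  fun_arity : fun_symb -> nat;
  rel_symb : Type;
  rel_arity : rel_symb -> nat }.

(* Terms and formulas of the expansion of [L] by constants from [C], with free
   variables in [V].  Formulas are nested: in [fex phi] the variable [None] of
   [phi] is bound and [Some v] is the variable [v] of the context. *)
Inductive term (L : language) (C V : Type) :=
| tvar of V
| tcst of C
| tapp (F : fun_symb L) of ('I_(fun_arity F) -> term L C V).

Inductive formula (L : language) (C : Type) : Type -> Type :=
| feq V of term L C V & term L C V : formula L C V
| frel V (R : rel_symb L) of ('I_(rel_arity R) -> term L C V) : formula L C V
| fnot V of formula L C V : formula L C V
| fand V of formula L C V & formula L C V : formula L C V
| fex V of formula L C (option V) : formula L C V.

Definition sentence (L : language) := formula L void void.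
Definition theory (L : language) := set (sentence L).

Record structure (L : language) := Structure {
  carrier :> Type;
  carrier_inhabited : inhabited carrier;
  fun_interp : forall F : fun_symb L, ('I_(fun_arity F) -> carrier) -> carrier;
  rel_interp : forall R : rel_symb L, ('I_(rel_arity R) -> carrier) -> Prop }.

Section Satisfaction.
Context (L : language) (M : structure L) (C : Type) (c : C -> M).

Fixpoint eval V (v : V -> M) (t : term L C V) : M :=
  match t with
  | tvar x => v x
  | tcst a => c a
  | tapp F u => fun_interp (fun i => eval v (u i))
  end.

Definition vcons V (a : M) (v : V -> M) (x : option V) : M :=
  if x is Some y then v y else a.

Fixpoint sat V (phi : formula L C V) : (V -> M) -> Prop :=
  match phi in formula _ _ V return (V -> M) -> Prop with
  | feq _ t u => fun v => eval v t = eval v u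
  | frel _ R u => fun v => rel_interp (fun i => eval v (u i))
  | fnot _ phi => fun v => ~ sat phi v
  | fand _ phi psi => fun v => sat phi v /\ sat psi v
  | fex _ phi => fun v => exists a, sat phi (vcons a v)
  end.

End Satisfaction.

Definition models (L : language) (M : structure L) (T : theory L) :=
  forall phi, T phi -> sat (of_void M) phi (of_void M).

(* [formula L M V] is the set of L(M)-formulas; [a : M] is the name of [a]. *)
Definition satM (L : language) (M : structure L) V (v : V -> M)
  (phi : formula L M V) := sat id phi v.

Definition definable (L : language) (M : structure L) (A : set M) :=
  exists phi : formula L M unit, A = [set a | satM (fun=> a) phi].

Section Ominimal.
Context (L : language) (R : rel_symb L).

(* Only used when [rel_arity R = 2]. *)
Definition rel2 (M : structure L) (a b : M) : Prop :=
  @rel_interp L M R (fun i => if nat_of_ord i is 0 then a else b).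

Definition linear_order (M : structure L) :=
  [/\ forall a : M, ~ rel2 a a,
      forall a b d : M, rel2 a b -> rel2 b d -> rel2 a d
    & forall a b : M, [\/ rel2 a b, a = b | rel2 b a]].

(* [None] is -oo as a left endpoint and +oo as a right endpoint. *)
Definition interval (M : structure L) (I : option M * option M) : set M :=
  [set x | (if I.1 is Some a then rel2 a x else True) /\
           (if I.2 is Some b then rel2 x b else True)].

Definition o_minimal (T : theory L) :=
  forall M : structure L, models M T ->
    linear_order M /\
    forall A : set M, definable A ->
      exists (P : set M) (J : set (option M * option M)),
        [/\ finite_set P, finite_set J
          & A = P `|` \bigcup_(I in J) interval I].

End Ominimal.

Section Types.
Context (L : language) (M : structure L) (V : Type).

Definition finitely_satisfiable (p : set (formula L M V)) :=
  forall n (phi : 'I_n -> formula L M V), (forall i, p (phi i)) ->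
    exists v : V -> M, forall i, satM v (phi i).

Definition complete (p : set (formula L M V)) := forall phi, p phi \/ p (fnot phi).

Record type_space := CompleteType {
  type_set :> formula L M V -> Prop;
  type_fsat : finitely_satisfiable type_set;
  type_complete : complete type_set }.

Lemma type_ext (p q : type_space) :
  (forall phi, p phi <-> q phi) -> p = q.
Proof.
case: p q => [p p1 p2] [q q1 q2] /= pq.
have e : p = q by apply/seteqP; split=> x /pq.
by subst q; congr CompleteType; exact: Prop_irrelevance.
Qed.

Lemma type_sat (p : type_space) (s : seq (formula L M V)) (x0 : formula L M V) :
  (forall i, (i < size s)%N -> p (nth x0 s i)) ->
  exists v : V -> M, forall i, (i < size s)%N -> satM v (nth x0 s i).
Proof.
move=> ps; have [|v vs] := @type_fsat p (size s) (fun i => nth x0 s i).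
  by move=> i; apply: ps.
by exists v => i ilt; apply: (vs (Ordinal ilt)).
Qed.

Lemma type_not (p : type_space) phi : p (fnot phi) <-> ~ p phi.
Proof.
split=> [np pp|]; last by case: (type_complete p phi).
have [|v vs] := @type_sat p [:: phi; fnot phi] phi.
  by case=> [|[|]].
exact: (vs 1%N erefl (vs 0%N erefl)).
Qed.

Lemma type_and (p : type_space) phi psi :
  p (fand phi psi) <-> p phi /\ p psi.
Proof.
split=> [pa|[p1 p2]].
- split; apply: contrapT => /type_not np.
  + have [|v vs] := @type_sat p [:: fand phi psi; fnot phi] phi.
      by case=> [|[|]].
    by case: (vs 0%N erefl) => a _; exact: (vs 1%N erefl a).
  + have [|v vs] := @type_sat p [:: fand phi psi; fnot psi] phi.
      by case=> [|[|]].
    by case: (vs 0%N erefl) => _ a; exact: (vs 1%N erefl a).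
- apply: contrapT => /type_not np.
  have [|v vs] := @type_sat p [:: fnot (fand phi psi); phi; psi] phi.
    by case=> [|[|[|]]].
  exact: (vs 0%N erefl (conj (vs 1%N erefl) (vs 2%N erefl))).
Qed.

Definition ftrue : formula L M V := fex (feq (tvar _ _ None) (tvar _ _ None)).

Lemma type_true (p : type_space) : p ftrue.
Proof.
apply: contrapT => /type_not np.
have [|v vs] := @type_sat p [:: fnot ftrue] ftrue; first by case.
have [a] := carrier_inhabited M.
by apply: (vs 0%N erefl); exists a.
Qed.

HB.instance Definition _ := gen_eqMixin type_space.
HB.instance Definition _ := gen_choiceMixin type_space.

Definition type_open : set_system type_space :=
  [set U : set type_space | forall p : type_space, U p ->
     exists phi, p phi /\ [set q : type_space | q phi] `<=` U].

Lemma type_openT : type_open setT.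
Proof. by move=> p _; exists ftrue; split=> //; exact: type_true. Qed.

Lemma type_openI : setI_closed type_open.
Proof.
move=> A B oA oB p [/oA[f [pf fA]] /oB[g [pg gB]]].
exists (fand f g); split; first by apply/type_and.
by move=> q /type_and[qf qg]; split; [exact: fA|exact: gB].
Qed.

Lemma type_open_bigU (I : Type) (f : I -> set type_space) :
  (forall i, type_open (f i)) -> type_open (\bigcup_i f i).
Proof.
move=> of_ p [i _ /of_[phi [pp sub]]]; exists phi; split=> //.
by move=> q /sub; exists i.
Qed.

HB.instance Definition _ := isOpenTopological.Build type_space
  type_openT type_openI type_open_bigU.

Lemma type_openE : open = type_open. Proof. by []. Qed.

Lemma nbhs_typeP (p : type_space) (A : set type_space) :
  nbhs p A <-> exists phi, p phi /\ [set q : type_space | q phi] `<=` A.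
Proof.
rewrite nbhsE /open_nbhs type_openE; split=> [[U [oU Up] UA]|[phi [pp sub]]].
  by have [phi [pp sub]] := oU p Up; exists phi; split=> // q /sub /UA.
exists [set q : type_space | q phi]; last exact: sub.
by split; [move=> q qp; exists phi; split|].
Qed.

Lemma nbhs_type (p : type_space) phi :
  p phi -> nbhs p [set q : type_space | q phi].
Proof. by move=> pphi; apply/nbhs_typeP; exists phi; split. Qed.

Lemma type_space_hausdorff : hausdorff_space type_space.
Proof.
move=> p q pq; apply: type_ext.
have key (r s : type_space) : cluster (nbhs r) s -> forall phi, r phi -> s phi.
  move=> rs phi rphi; apply: contrapT => /type_not sphi.
  have [||t [/= t1 /type_not]] //:= rs [set t : type_space | t phi]
                     [set t : type_space | t (fnot phi)].
  - exact: nbhs_type.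
  - exact: nbhs_type.
move=> phi; split; first exact: key.
apply: key => A B nA nB.
by have [x [? ?]] := pq _ _ nB nA; exists x.
Qed.

Lemma type_space_compact : compact [set: type_space].
Proof.
rewrite compact_ultra => F FU _.
pose p0 : set (formula L M V) := [set phi | F [set q : type_space | q phi]].
have p0c : complete p0.
  move=> phi; have [|] := in_ultra_setVsetC [set q : type_space | q phi] FU.
    by left.
  by right; apply: filterS b => q /= /type_not.
have p0s : finitely_satisfiable p0.
  move=> n phi p0phi.
  have /filter_ex [q qphi] : F [set q : type_space | forall i, q (phi i)].
    exact: filter_forall.
  exact: type_fsat qphi.
exists (CompleteType p0s p0c); split=> // A /nbhs_typeP [phi [/= Fphi sub]].
exact: filterS Fphi.
Qed.

End Types.

Section Automorphisms.
Context (L : language) (M : structure L).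

Record automorphism := Automorphism {
  aut_fun :> M -> M;
  aut_inv : M -> M;
  aut_funK : cancel aut_fun aut_inv;
  aut_invK : cancel aut_inv aut_fun;
  aut_fun_interp : forall (F : fun_symb L) (a : 'I_(fun_arity F) -> M),
    aut_fun (fun_interp a) = fun_interp (aut_fun \o a);
  aut_rel_interp : forall (R : rel_symb L) (a : 'I_(rel_arity R) -> M),
    rel_interp a <-> rel_interp (aut_fun \o a) }.

Lemma aut_ext (g h : automorphism) : g =1 h -> g = h.
Proof.
case: g h => [g g' gK g'K gf gr] [h h' hK h'K hf hr] /= gh.
have e : g = h by apply/funext.
subst h; have e : g' = h' by apply/funext => x; rewrite -{1}(h'K x) gK.
by subst h'; congr Automorphism; exact: Prop_irrelevance.
Qed.

HB.instance Definition _ := gen_eqMixin automorphism.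
HB.instance Definition _ := gen_choiceMixin automorphism.

Definition aut_one : automorphism.
Proof. by apply: (@Automorphism id id). Defined.

Definition aut_inverse (g : automorphism) : automorphism.
Proof.
apply: (@Automorphism (aut_inv g) g).
- exact: aut_invK.
- exact: aut_funK.
- move=> F a; apply: (can_inj (aut_funK g)); rewrite aut_invK aut_fun_interp.
  by congr fun_interp; apply/funext => i /=; rewrite aut_invK.
- move=> R a; rewrite (aut_rel_interp g (_ \o _)).
  by have -> : g \o (aut_inv g \o a) = a
    by apply/funext => i /=; rewrite aut_invK.
Defined.

Definition aut_mul (g h : automorphism) : automorphism.
Proof.
apply: (@Automorphism (g \o h) (aut_inv h \o aut_inv g)).
- by move=> x /=; rewrite !aut_funK.
- by move=> x /=; rewrite !aut_invK.
- by move=> F a /=; rewrite !aut_fun_interp.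
- by move=> R a; rewrite (aut_rel_interp h) (aut_rel_interp g).
Defined.

Lemma aut_mulA : associative aut_mul.
Proof. by move=> g h k; apply: aut_ext. Qed.
Lemma aut_mul1 : left_id aut_one aut_mul.
Proof. by move=> g; apply: aut_ext. Qed.
Lemma aut_1mul : right_id aut_one aut_mul.
Proof. by move=> g; apply: aut_ext. Qed.
Lemma aut_mulV : left_inverse aut_one aut_inverse aut_mul.
Proof. by move=> g; apply: aut_ext => x /=; rewrite aut_funK. Qed.
Lemma aut_Vmul : right_inverse aut_one aut_inverse aut_mul.
Proof. by move=> g; apply: aut_ext => x /=; rewrite aut_invK. Qed.

HB.instance Definition _ := isGroup.Build automorphism
  aut_mulA aut_mul1 aut_1mul aut_mulV aut_Vmul.

Definition agree_on (A : set M) (g : automorphism) : set automorphism :=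
  [set h : automorphism | forall a, A a -> h a = g a].

Definition aut_open : set_system automorphism :=
  [set U : set automorphism | forall g : automorphism, U g ->
     exists A : set M, finite_set A /\ agree_on A g `<=` U].

Lemma aut_openT : aut_open setT.
Proof. by move=> g _; exists set0; split. Qed.

Lemma aut_openI : setI_closed aut_open.
Proof.
move=> A B oA oB g [/oA[S [fS SA]] /oB[T [fT TB]]].
exists (S `|` T); split; first by rewrite finite_setU.
by move=> h hST; split; [apply: SA|apply: TB] => a ?; apply: hST; [left|right].
Qed.

Lemma aut_open_bigU (I : Type) (f : I -> set automorphism) :
  (forall i, aut_open (f i)) -> aut_open (\bigcup_i f i).
Proof.
move=> of_ g [i _ /of_[A [fA sub]]]; exists A; split=> //.
by move=> h /sub; exists i.
Qed.

HB.instance Definition _ := isOpenTopological.Build automorphism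
  aut_openT aut_openI aut_open_bigU.

Lemma aut_openE : open = aut_open. Proof. by []. Qed.

Lemma nbhs_autP (g : automorphism) (U : set automorphism) :
  nbhs g U <-> exists A : set M, finite_set A /\ agree_on A g `<=` U.
Proof.
rewrite nbhsE /open_nbhs aut_openE; split=> [[W [oW Wg] WU]|[A [fA sub]]].
  by have [A [fA sub]] := oW g Wg; exists A; split=> // h /sub /WU.
exists (agree_on A g) => //; split=> // h hA.
by exists A; split=> // k kh a Aa; rewrite kh// hA.
Qed.

End Automorphisms.

HB.mixin Record isTopologicalGroup G & Group G & Topological G := {
  mulg_continuous : continuous (fun gh : G * G => (gh.1 * gh.2)%g);
  invg_continuous : continuous (fun g : G => g^-1%g) }.

#[short(type="topGroupType")]
HB.structure Definition TopologicalGroup :=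
  {G of Group G & Topological G & isTopologicalGroup G}.

Record dynamical_system (X : topologicalType) (G : topGroupType) :=
  DynamicalSystem {
    ds_act :> G -> X -> X;
    ds_act1 : forall x, ds_act 1%g x = x;
    ds_actM : forall g h x, ds_act (g * h)%g x = ds_act g (ds_act h x);
    ds_continuous : continuous (fun gx : G * X => ds_act gx.1 gx.2);
    ds_compact : compact [set: X];
    ds_hausdorff : hausdorff_space X }.

Definition ellis (X : topologicalType) (G : topGroupType)
    (S : dynamical_system X G) : set {ptws X -> X} :=
  closure (range (fun g => S g : {ptws X -> X})).

Section TypeSystem.
Context (L : language) (M : structure L).

Lemma aut_mulg_continuous :
  continuous (fun gh : automorphism M * automorphism M => (gh.1 * gh.2)%g).
Proof.
move=> [g h] U /nbhs_autP [A [fA sub]].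
exists (agree_on (h @` A) g, agree_on A h) => /=.
  split; apply/nbhs_autP.
  - by exists (h @` A); split=> //; exact: finite_image.
  - by exists A; split.
move=> [g' h'] /= [gg' hh']; apply: sub => a Aa /=.
by rewrite hh'// gg'//; exists a.
Qed.

Lemma aut_invg_continuous :
  continuous (fun g : automorphism M => (g^-1)%g).
Proof.
move=> g U /nbhs_autP [A [fA sub]]; apply/nbhs_autP.
exists (aut_inv g @` A); split; first exact: finite_image.
move=> h hA; apply: sub => a Aa /=.
apply: (can_inj (aut_funK h)); rewrite aut_invK hA ?aut_invK//.
Qed.

HB.instance Definition _ := isTopologicalGroup.Build (automorphism M)
  aut_mulg_continuous aut_invg_continuous.

Fixpoint tmap C D V (g : C -> D) (t : term L C V) : term L D V :=
  match t with
  | tvar x => tvar L D x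
  | tcst a => tcst L V (g a)
  | tapp F u => tapp (fun i => tmap g (u i))
  end.

(* For [phi = phi(x, b)] with [b] in [C], [fmap g phi] is [phi(x, g(b))]. *)
Fixpoint fmap C D V (g : C -> D) (phi : formula L C V) : formula L D V :=
  match phi with
  | feq _ t u => feq (tmap g t) (tmap g u)
  | frel _ R u => frel (fun i => tmap g (u i))
  | fnot _ phi => fnot (fmap g phi)
  | fand _ phi psi => fand (fmap g phi) (fmap g psi)
  | fex _ phi => fex (fmap g phi)
  end.

Lemma tmap_comp C D E V (g : D -> E) (h : C -> D) (t : term L C V) :
  tmap g (tmap h t) = tmap (g \o h) t.
Proof. by elim: t => //= F u IH; congr tapp; apply/funext. Qed.

Lemma fmap_comp C D E V (g : D -> E) (h : C -> D) (phi : formula L C V) :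
  fmap g (fmap h phi) = fmap (g \o h) phi.
Proof.
elim: phi => {V} //= V.
- by move=> t u; rewrite !tmap_comp.
- by move=> R u; congr frel; apply/funext => i; rewrite tmap_comp.
- by move=> phi ->.
- by move=> phi -> psi ->.
- by move=> phi ->.
Qed.

Lemma tmap_id C V (t : term L C V) : tmap id t = t.
Proof. by elim: t => //= F u IH; congr tapp; apply/funext. Qed.

Lemma fmap_id C V (phi : formula L C V) : fmap id phi = phi.
Proof.
elim: phi => {V} //= V.
- by move=> t u; rewrite !tmap_id.
- by move=> R u; congr frel; apply/funext => i; rewrite tmap_id.
- by move=> phi ->.
- by move=> phi -> psi ->.
- by move=> phi ->.
Qed.

Lemma eval_tmap C D V (c : D -> M) (g : C -> D) (v : V -> M) (t : term L C V) :
  eval c v (tmap g t) = eval (c \o g) v t.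
Proof. by elim: t => //= F u IH; congr fun_interp; apply/funext. Qed.

Lemma sat_fmap C D V (c : D -> M) (g : C -> D) (phi : formula L C V) v :
  sat c (fmap g phi) v <-> sat (c \o g) phi v.
Proof.
elim: phi v => {V} /= V.
- by move=> t u v; rewrite !eval_tmap.
- move=> R u v.
  by under eq_fun do rewrite eval_tmap.
- by move=> phi IH v; rewrite IH.
- by move=> phi IH psi IH' v; rewrite IH IH'.
- by move=> phi IH v; split=> -[a /IH]; exists a.
Qed.

Lemma eval_aut (g : automorphism M) C V (c : C -> M) (v : V -> M)
    (t : term L C V) : eval (g \o c) (g \o v) t = g (eval c v t).
Proof.
elim: t => //= F u IH; rewrite aut_fun_interp.
by congr fun_interp; apply/funext.
Qed.

Lemma sat_aut (g : automorphism M) C V (c : C -> M) (phi : formula L C V) v :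
  sat (g \o c) phi (g \o v) <-> sat c phi v.
Proof.
elim: phi v => {V} /= V.
- by move=> t u v; rewrite !eval_aut; split=> [/(can_inj (aut_funK g))|->].
- move=> R u v; rewrite [X in _ <-> X](aut_rel_interp g).
  by under eq_fun do rewrite eval_aut.
- by move=> phi IH v; rewrite IH.
- by move=> phi IH psi IH' v; rewrite IH IH'.
- have vE a v : vcons (g a) (g \o v) = g \o vcons a v :> (option V -> M).
    by apply/funext => -[].
  move=> phi IH v; split=> -[a].
  + rewrite -(aut_invK g a) vE => /IH; by exists (aut_inv g a).
  + by move=> /IH; rewrite -vE; exists (g a).
Qed.

Context (V : Type).

Definition type_act_set (g : automorphism M) (p : type_space M V) :
  set (formula L M V) := [set phi | p (fmap (g^-1)%g phi)].

Lemma type_act_fsat g p : finitely_satisfiable (type_act_set g p).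
Proof.
move=> n phi /(type_fsat) [v vs]; exists (g \o v) => i.
have /sat_fmap := vs i; rewrite /= => H.
apply/(sat_aut (g^-1)%g).
rewrite (_ : _ \o (g \o v) = v)//.
by apply/funext => x /=; rewrite aut_funK.
Qed.

Lemma type_act_complete g p : complete (type_act_set g p).
Proof. by move=> phi; exact: (type_complete p (fmap _ phi)). Qed.

Definition type_act (g : automorphism M) (p : type_space M V) : type_space M V :=
  CompleteType (@type_act_fsat g p) (@type_act_complete g p).

Lemma type_actE (g : automorphism M) (p : type_space M V) phi :
  type_act g p (fmap g phi) <-> p phi.
Proof.
rewrite /type_act /= /type_act_set /= fmap_comp.
rewrite (_ : _ \o _ = id) ?fmap_id//.
by apply/funext => x /=; rewrite aut_funK.
Qed.

Lemma type_act1 p : type_act 1%g p = p.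
Proof.
apply: type_ext => phi; change (p (fmap id phi) <-> p phi).
by rewrite fmap_id.
Qed.

Lemma type_actM (g h : automorphism M) p :
  type_act (g * h)%g p = type_act g (type_act h p).
Proof.
apply: type_ext => phi.
change (p (fmap (aut_inv h \o aut_inv g) phi) <->
        p (fmap (aut_inv h) (fmap (aut_inv g) phi))).
by rewrite fmap_comp.
Qed.

Fixpoint tcsts C W (t : term L C W) : set C :=
  match t with
  | tvar _ => set0
  | tcst a => [set a]
  | tapp F u => \bigcup_i tcsts (u i)
  end.

Fixpoint fcsts C W (phi : formula L C W) : set C :=
  match phi with
  | feq _ t u => tcsts t `|` tcsts u
  | frel _ R u => \bigcup_i tcsts (u i)
  | fnot _ phi => fcsts phi
  | fand _ phi psi => fcsts phi `|` fcsts psi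
  | fex _ phi => fcsts phi
  end.

Lemma tcsts_finite C W (t : term L C W) : finite_set (tcsts t).
Proof.
elim: t => //= F u IH.
by apply: bigcup_finite => //; exact: finite_finset.
Qed.

Lemma fcsts_finite C W (phi : formula L C W) : finite_set (fcsts phi).
Proof.
elim: phi => {W} //= W.
- by move=> t u; rewrite finite_setU; split; exact: tcsts_finite.
- move=> R u; apply: bigcup_finite => *; first exact: finite_finset.
  exact: tcsts_finite.
- by move=> *; rewrite finite_setU.
Qed.

Lemma eq_tmap C D W (g h : C -> D) (t : term L C W) :
  (forall a, tcsts t a -> g a = h a) -> tmap g t = tmap h t.
Proof.
elim: t => //= [a gh|F u IH gh]; first by rewrite gh.
by congr tapp; apply/funext => i; apply: IH => a ai; apply: gh; exists i.
Qed.

Lemma eq_fmap C D W (g h : C -> D) (phi : formula L C W) :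
  (forall a, fcsts phi a -> g a = h a) -> fmap g phi = fmap h phi.
Proof.
elim: phi => {W} /= W.
- by move=> t u gh; congr feq; apply: eq_tmap => a ?; apply: gh; [left|right].
- move=> R u gh; congr frel; apply/funext => i; apply: eq_tmap => a ai.
  by apply: gh; exists i.
- by move=> phi IH gh; rewrite IH.
- move=> phi IH psi IH' gh.
  by rewrite IH ?IH'// => a ?; apply: gh; [right|left].
- by move=> phi IH gh; rewrite IH.
Qed.

Lemma type_act_continuous :
  continuous (fun gp : automorphism M * type_space M V => type_act gp.1 gp.2).
Proof.
move=> [g p] U /nbhs_typeP [phi [pphi sub]].
pose A := aut_inv g @` fcsts phi.
exists (agree_on A g, [set q : type_space M V | q (fmap (g^-1)%g phi)]) => /=.
  split.
  - apply/nbhs_autP; exists A; split=> //.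
    by apply: finite_image; exact: fcsts_finite.
  - exact: nbhs_type.
move=> [h q] /= [hA qphi]; apply: sub => /=.
rewrite /type_act_set /= (@eq_fmap _ _ _ _ (g^-1)%g)// => a ca /=.
apply: (can_inj (aut_funK h)); rewrite aut_invK hA ?aut_invK//.
by exists a.
Qed.

Definition type_system : dynamical_system (type_space M V) (automorphism M) :=
  DynamicalSystem type_act1 type_actM type_act_continuous
    (@type_space_compact L M V) (@type_space_hausdorff L M V).

End TypeSystem.

(* Ordinals up to the equivalence generated by [ord_le]; [olim a] denotes the
   supremum of the family [a], which need not be increasing nor nonempty. *)
Inductive ord : Type :=
| ozero
| osucc of ord
| olim (I : Type) of (I -> ord).

Fixpoint ord_le (a b : ord) {struct a} : Prop :=
  match a with
  | ozero => True
  | osucc a =>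
      (fix lt (b : ord) : Prop :=
         match b with
         | ozero => False
         | osucc b => ord_le a b
         | olim _ b => exists i, lt (b i)
         end) b
  | olim _ a => forall i, ord_le (a i) b
  end.

Definition ord_lt (a b : ord) := ord_le (osucc a) b.

Lemma ord_le_lim a I (f : I -> ord) i : ord_le a (f i) -> ord_le a (olim f).
Proof. by elim: a => //= [a _|J g IH]; [exists i|move=> H j; exact: IH]. Qed.

Lemma ord_le_refl a : ord_le a a.
Proof. by elim: a => //= I f IH i; exact: ord_le_lim (IH i). Qed.

Lemma ord_le_succ a b : ord_le a b -> ord_le a (osucc b).
Proof.
elim: a b => //= [a IHa b|I f IH b H i].
  elim: b => //= [b _ ab|I f IH [i ai]]; first exact: IHa.
  exact: ord_le_lim (IH i ai).
exact/IH/H.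
Qed.

Lemma ord_le_trans b a c : ord_le a b -> ord_le b c -> ord_le a c.
Proof.
elim: b a c => [|b IHb|J g IHb] a; elim: a => [|a _|I f IHa] c //=.
- by move=> H _ i; exact: (IHa i).
- move=> ab; elim: c => //= [c _|I f IH [i ?]]; first exact: IHb.
  by exists i; exact: IH.
- by move=> H bc i; exact: (IHa i).
- by move=> [j aj] gc; exact: (IHb j (osucc a)).
- by move=> H bc i; exact: (IHa i).
Qed.

Lemma ord_ltW a b : ord_lt a b -> ord_le a b.
Proof. by apply: ord_le_trans; apply: ord_le_succ; exact: ord_le_refl. Qed.

Lemma ord_leVlt a b : ord_le a b \/ ord_lt b a.
Proof.
elim: a b => [|a IHa|I f IH] b; first by left.
- elim: b => [|b _|J g IHb]; first by right.
  + by case: (IHa b); [left|right].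
  + have [[j gj]|nE] := pselect (exists j, ord_le (osucc a) (g j)).
      by left; exists j.
    right=> /= j; case: (IHb j) => // aj.
    by exfalso; apply: nE; exists j.
- have [[i fi]|nE] := pselect (exists i, ord_lt b (f i)).
    by right; exists i.
  left=> /= i; case: (IH i b) => // bi.
  by exfalso; apply: nE; exists i.
Qed.

Lemma ord_lt_wf : well_founded ord_lt.
Proof.
suff H a b : ord_le b a -> Acc ord_lt b by move=> a; apply: H (ord_le_refl a).
elim: a b => [|a IH|I f IH] b ba; apply: Acc_intro => c cb.
- by case: (ord_le_trans cb ba).
- exact: IH (ord_le_trans cb ba).
- by case: (ord_le_trans cb ba) => i ci; exact: IH i _ (ord_ltW ci).
Qed.

Lemma ord_lt_irr a : ~ ord_lt a a.
Proof. by elim/(well_founded_ind ord_lt_wf): a => a IH H; exact: (IH a H H). Qed.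

Definition ord_limit c :=
  ord_lt ozero c /\ forall a, ord_lt a c -> ord_lt (osucc a) c.

(* Ordinals together with infinity, which is [None].  Collections of ordinals
   are predicates [eord -> Prop]: the type [set eord] would force the universe
   of [ord] below that of topological spaces. *)
Definition eord := option ord.

Definition eord_le (a b : eord) : Prop :=
  match a, b with
  | _, None => True
  | None, Some _ => False
  | Some a, Some b => ord_le a b
  end.

Definition is_esup (A : eord -> Prop) (s : eord) :=
  (forall a, A a -> eord_le a s) /\
  (forall b, (forall a, A a -> eord_le a b) -> eord_le s b).

Lemma esup_exists (A : eord -> Prop) : exists s, is_esup A s.
Proof.
have [[c Ac]|nE] := pselect (exists c, forall a, A a -> eord_le a (Some c)).
  elim/(well_founded_ind ord_lt_wf): c Ac => c IH Ac.
  have [[b [bc Ab]]|nE] :=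
    pselect (exists b, ord_lt b c /\ forall a, A a -> eord_le a (Some b)).
    exact: (IH b bc Ab).
  exists (Some c); split=> // -[b|]// Ab.
  have [//|bc] := ord_leVlt c b.
  by exfalso; apply: nE; exists b.
exists None; split=> [[]//|[b|]// Ab].
by apply: nE; exists b.
Qed.

Definition esup (A : eord -> Prop) : eord := projT1 (cid (esup_exists A)).

Lemma esupP (A : eord -> Prop) : is_esup A (esup A).
Proof. exact: projT2 (cid (esup_exists A)). Qed.

(* The uniformity of a compact Hausdorff space: all neighbourhoods of the
   diagonal. *)
Definition diag_nbhs (X : topologicalType) : set_system (X * X) :=
  [set W : set (X * X) | forall x : X, nbhs (x, x) W].
Arguments diag_nbhs : clear implicits.

Section Beta.
Context (X : topologicalType).
Implicit Types (Y : set X) (f : X -> X) (W : set (X * X)).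

(* The open neighbourhoods of [y] in [Y] are the [V `&` Y] with [V] open in
   [X] and containing [y]. *)
Definition osc_deriv f W Y : set X :=
  [set y | Y y /\ forall V : set X, open V -> V y ->
     exists v1 v2, [/\ (V `&` Y) v1, (V `&` Y) v2 & ~ W (f v1, f v2)]].

Fixpoint osc_iter f W Y (a : ord) : set X :=
  match a with
  | ozero => Y
  | osucc a => osc_deriv f W (osc_iter f W Y a)
  | olim _ a => Y `&` \bigcap_i osc_iter f W Y (a i)
  end.

Lemma osc_deriv_sub f W Y : osc_deriv f W Y `<=` Y.
Proof. by move=> y []. Qed.

Lemma osc_derivS f W Y Z : Y `<=` Z -> osc_deriv f W Y `<=` osc_deriv f W Z.
Proof.
move=> YZ y [Yy H]; split; first exact: YZ.
move=> V oV Vy; have [v1 [v2 [[? ?] [? ?] ?]]] := H V oV Vy.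
by exists v1, v2; split=> //; split=> //; exact: YZ.
Qed.

Lemma osc_iter_sub f W Y a : osc_iter f W Y a `<=` Y.
Proof.
elim: a => [|a IH|I a IH] //=.
by apply: subset_trans IH; exact: osc_deriv_sub.
Qed.

Lemma osc_iter_mono f W Y a b :
  ord_le a b -> osc_iter f W Y b `<=` osc_iter f W Y a.
Proof.
elim: a b => [b _|a IHa|I c IH b H]; first exact: osc_iter_sub.
- elim=> //= [b _ ab|J g IHb [j aj] y [_ gy]].
    by apply: osc_derivS; exact: IHa.
  by apply: (IHb j aj); exact: gy.
- move=> y by_; split; first exact: osc_iter_sub by_.
  by move=> i _; apply: (IH i b) => //; exact: H.
Qed.

(* For a limit ordinal [c], the clause of [olim] agrees with the intersection over all
   smaller ordinals. *)
Lemma osc_iter_limit f W Y c : ord_limit c ->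
  osc_iter f W Y c = [set y | forall a, ord_lt a c -> osc_iter f W Y a y].
Proof.
move=> limc; apply/seteqP; split=> [y cy a /ord_ltW ac|y /=].
  exact: osc_iter_mono cy.
elim: c limc => [[]//|c _ [_ /(_ c)]|I g IH [l0 lS] H].
  by move=> /(_ (ord_le_refl _)) /ord_lt_irr.
split=> [|i _]; first exact: (H ozero).
have [gi|gi] := ord_leVlt (olim g) (g i); last exact: H.
have gi' : ord_le (g i) (olim g) by apply: (@ord_le_lim _ _ g i); exact: ord_le_refl.
apply: IH => [|a ai]; last by apply: H; exact: ord_le_trans ai gi'.
split=> [|a ai]; first exact: ord_le_trans l0 gi.
by apply: ord_le_trans gi; apply: lS; exact: ord_le_trans ai gi'.
Qed.

(* Suprema are indexed by a universe containing [X], so [ord] is long enough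
   for the derivatives to stabilize. *)
Lemma osc_iter_stable f W Y :
  exists a, forall b, osc_iter f W Y a `<=` osc_iter f W Y b.
Proof.
have H (x : X) : exists a, (exists b, ~ osc_iter f W Y b x) -> ~ osc_iter f W Y a x.
  have [[b bx]|nE] := pselect (exists b, ~ osc_iter f W Y b x).
    by exists b.
  by exists ozero => /nE.
have [r rP] := choice H.
exists (olim r) => b y [_ ry]; apply: contrapT => nb.
by apply: (rP y); [exists b|exact: ry].
Qed.

(* [esup] of the empty set is 0, and of an unbounded set of ordinals is
   infinity. *)
Definition beta_at f W Y : eord :=
  esup (fun s => exists2 a : ord, osc_iter f W Y a !=set0 & s = Some a).

Definition beta f : eord :=
  esup (fun s => exists2 W, diag_nbhs X W & s = beta_at f W [set: X]).

End Beta.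

Definition beta_system (X : topologicalType) (G : topGroupType)
    (S : dynamical_system X G) : eord :=
  esup (fun s => exists2 f, ellis S f & s = beta f).

(* Main.v *)
Require Import Defs.
From mathcomp Require Import all_boot all_classical topology.

Set Implicit Arguments.
Unset Strict Implicit.
Unset Printing Implicit Defensive.

Local Open Scope classical_set_scope.

(** The complete 1-types of an o-minimal structure are linearly ordered by
    their cuts, automorphisms preserve this order, and hence so does every [f]
    in the Ellis semigroup, as a pointwise limit of automorphisms.  A monotone
    map can only jump at few points.  In detail:

    By compactness and o-minimality an entourage [W] contains every pair of
    types which agree on some finite set of formulas of the form [a < x] or
    [~ x < a] ([agreement_entourage]).  So a point at which [f] oscillates
    by more than [W] lies on the boundary of [[set p | f p d]] for one of these
    finitely many formulas [d].  This set is a final segment of the types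
    ([ellis_final]), and the boundary of a final segment has at most two
    points, its minimum and the maximum of its complement
    ([boundary_final_finite]).  Thus the first derivative is finite, and since
    a finite subset of a Hausdorff space is discrete, the second derivative is
    empty.

    About the order the argument uses only that the formulas [a < x] and
    [~ x < a] define final segments: their solution sets form a chain, which
    is invariant under automorphisms.  It is therefore carried out for any
    family [D] of formulas with these two properties such that the truth of
    each formula depends only on finitely many members of [D]. *)

(** * Finite intersections and derivatives of finite sets *)

Lemma filter_bigcap_finite T I (D : set I) (A : I -> set T)
    (F : set_system T) : finite_set D -> Filter F ->
  (forall i, D i -> F (A i)) -> F (\bigcap_(i in D) A i).
Proof.
elim/Pchoice: I => I in D A *.
move=> /finite_fsetP [E ->] FF FA; exact: filter_bigI.
Qed.

Lemma osc_deriv_finite (X : topologicalType) (f : X -> X) W (F : set X) :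
  hausdorff_space X -> diag_nbhs X W -> finite_set F -> osc_deriv f W F = set0.
Proof.
move=> hX dW finF; apply/seteqP; split=> // y [Fy yosc].
have clF : closed (F `\ y).
  apply: (accessible_finite_set_closed.1 (hausdorff_accessible hX)).
  exact: finite_setD.
have [||v1 [v2 [[v1F Fv1] [v2F Fv2]]]] := yosc (~` (F `\ y)).
- exact: closed_openC.
- by move=> [_ /(_ erefl)].
have Fy1 v : F v -> ~ (F `\ y) v -> v = y.
  by move=> Fv nv; apply: contrapT => vy; apply: nv.
rewrite (Fy1 v1)// (Fy1 v2)//; apply.
exact: nbhs_singleton (dW (f y)).
Qed.

(** A Hausdorff topology is discrete on a finite set, so a finite first
    derivative leaves nothing for the second. *)
Lemma beta_le1 (X : topologicalType) (f : X -> X) : hausdorff_space X ->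
  (forall W, diag_nbhs X W -> finite_set (osc_deriv f W setT)) ->
  eord_le (beta f) (Some (osucc ozero)).
Proof.
move=> hX fin; apply: (esupP _).2 => s [W dW ->].
apply: (esupP _).2 => _ [a [y ay] ->] /=.
have [//|/osc_iter_mono /(_ y ay) /=] := ord_leVlt a (osucc ozero).
by rewrite osc_deriv_finite//; exact: fin.
Qed.

(** * Realizing finitely much of a type *)

Section Types.
Context (L : language) (M : structure L) (V : Type).
Implicit Types (p q : type_space M V) (phi psi : formula L M V).

(** The filter of subsets of [V -> M] that a type generates: it lets the
    filter lemmas replace finite conjunctions of formulas. *)
Definition type_filter p : set_system (V -> M) :=
  [set A | exists2 phi, p phi & [set v | satM v phi] `<=` A].

Lemma type_filter_proper p : ProperFilter (type_filter p).
Proof.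
split.
  move=> [phi pphi sub].
  have [|v /(_ 0%N erefl) vphi] := @type_sat _ _ _ p [:: phi] phi.
    by case.
  exact: (sub v).
split.
- by exists (ftrue M V); first exact: type_true.
- move=> A B [phi pphi phiA] [psi ppsi psiB].
  exists (fand phi psi); first by apply/type_and.
  by move=> v [vphi vpsi]; split; [exact: phiA|exact: psiB].
- by move=> A B AB [phi pphi phiA]; exists phi => // v /phiA /AB.
Qed.

Lemma type_filter_sat p phi : p phi -> type_filter p [set v | satM v phi].
Proof. by move=> pphi; exists phi. Qed.

Lemma type_imp p phi psi :
  (forall v : V -> M, satM v phi -> satM v psi) -> p phi -> p psi.
Proof.
move=> imp pphi; apply: contrapT => /type_not npsi.
have FF := type_filter_proper p.
have [v [vphi]] := filter_ex (filterI (type_filter_sat pphi)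
                                      (type_filter_sat npsi)).
by apply; exact: imp.
Qed.

Definition agree (S : set (formula L M V)) p q :=
  forall d, S d -> (p d <-> q d).

Definition determined (S : set (formula L M V)) phi :=
  forall v w : V -> M, (forall d, S d -> (satM v d <-> satM w d)) ->
    satM v phi -> satM w phi.

(** If [p] contained [phi] but [q] did not, realizations of [phi] in [p] and
    of [fnot phi] in [q] with the same behaviour on the finite set [S] would
    contradict that [S] determines [phi]. *)
Lemma determined_agree S phi p q : finite_set S -> determined S phi ->
  agree S p q -> p phi -> q phi.
Proof.
move=> finS detS Spq pphi; apply: contrapT => /type_not nphi.
have profile (r : type_space M V) :
    type_filter r (\bigcap_(d in S) [set v | satM v d <-> r d]).
  have ? := type_filter_proper r.
  apply: filter_bigcap_finite => // d _.
  have [rd|nd] := type_complete r d.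
    by exists d => // v vd; split.
  by exists (fnot d) => // v /= vd; split=> // /((type_not r d).1 nd).
have FFp := type_filter_proper p; have FFq := type_filter_proper q.
have [v [vS vphi]] := filter_ex (filterI (profile p) (type_filter_sat pphi)).
have [w [wS]] := filter_ex (filterI (profile q) (type_filter_sat nphi)).
apply; apply: detS vphi => d Sd.
exact: iff_trans (vS d Sd) (iff_trans (Spq d Sd) (iff_sym (wS d Sd))).
Qed.

End Types.

(** * Structures with a chain of formulas that determines all others *)

Section Chain.
Context (L : language) (M : structure L) (V : Type).
Context (D : set (formula L M V)).
Implicit Types (p q : type_space M V).

Hypothesis D_chain : forall c d, D c -> D d ->
  (forall v : V -> M, satM v c -> satM v d) \/
  (forall v : V -> M, satM v d -> satM v c).
Hypothesis D_aut : forall (g : automorphism M) d, D d -> D (Defs.fmap g d).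
Hypothesis D_determines : forall phi : formula L M V,
  exists S, [/\ finite_set S, S `<=` D & determined S phi].

Definition type_lt p q := exists c, [/\ D c, q c & ~ p c].

Definition final (U : set (type_space M V)) :=
  forall p q, type_lt p q -> U p -> U q.

Lemma type_lt_total p q : p <> q -> type_lt p q \/ type_lt q p.
Proof.
move=> pq; apply: contrapT => nlt; apply: pq.
have Dpq : agree D p q.
  move=> d Dd; split=> [pd|qd]; apply: contrapT => nd; apply: nlt.
    by right; exists d.
  by left; exists d.
apply: type_ext => phi; have [S [finS SD detS]] := D_determines phi.
have Spq : agree S p q by move=> d /SD; exact: Dpq.
split; first exact: determined_agree detS Spq.
by apply: (determined_agree finS detS) => d Sd; exact: iff_sym (Spq d Sd).
Qed.

(** Two points of [U] on its boundary cannot be distinct: the larger one has a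
    neighbourhood above the smaller one, hence inside [U].  Dually for points
    outside [U]. *)
Lemma boundary_final_finite (U : set (type_space M V)) :
  final U -> finite_set (closure U `&` closure (~` U)).
Proof.
move=> finU.
have antichain_finite (A : set (type_space M V)) :
    (forall p q, A p -> A q -> ~ type_lt p q) -> finite_set A.
  move=> noltA; have [[p Ap]|nA] := pselect (A !=set0).
    apply: (sub_finite_set _ (finite_set1 p)) => q Aq /=.
    by apply: contrapT => /type_lt_total[]; exact: noltA.
  suff -> : A = set0 by exact: finite_set0.
  by apply/seteqP; split=> // q Aq; apply: nA; exists q.
apply: (@sub_finite_set _ _ ((U `&` closure (~` U)) `|`
                             (~` U `&` closure U))).
  by move=> p [clU clN]; have [Up|Np] := pselect (U p); [left|right].
rewrite finite_setU; split; apply: antichain_finite => p q.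
  move=> [Up _] [_ clq] [c [Dc qc npc]].
  have [r [nUr rc]] := clq _ (nbhs_type qc).
  by apply: nUr; apply: finU Up; exists c.
move=> [_ clp] [nUq _] [c [Dc qc npc]].
have [r [Ur /type_not nrc]] := clp _ (nbhs_type ((type_not p c).2 npc)).
by apply: nUq; apply: finU Ur; exists c.
Qed.

Lemma ellis_approx (f : type_space M V -> type_space M V) p q d :
  ellis (type_system M V) f -> exists g : automorphism M,
    (f p d <-> type_act g p d) /\ (f q d <-> type_act g q d).
Proof.
move=> /= fE.
have near_f r : nbhs (f : {ptws _ -> _})
    [set h : {ptws type_space M V -> type_space M V} | f r d <-> h r d].
  apply: (@proj_continuous _ (fun=> type_space M V) r f
            [set s : type_space M V | f r d <-> s d]).
  have [fd|nd] := type_complete (f r) d.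
    by apply/nbhs_typeP; exists d; split=> // s sd; split.
  apply/nbhs_typeP; exists (fnot d); split=> // s /type_not nsd.
  by split=> // /((type_not (f r) d).1 nd).
have [_ [[g _ <-] gpq]] := fE _ (filterI (near_f p) (near_f q)).
by exists g.
Qed.

(** Transport a member [d] of the chain by an automorphism that agrees with
    [f] at the two types in question, and compare the result with the member
    [c] that separates them. *)
Lemma ellis_final (f : type_space M V -> type_space M V) d :
  ellis (type_system M V) f -> D d -> final [set p | f p d].
Proof.
move=> fE Dd p q [c [Dc qc npc]] /=.
have [g [-> ->]] := ellis_approx p q d fE.
rewrite /= /type_act_set /= => pd.
have [cd|dc] := D_chain Dc (D_aut (g^-1)%g Dd).
  exact: type_imp cd qc.
by case: npc; exact: type_imp dc pd.
Qed.

(** Near each type the entourage [W] contains the square of a basic open set,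
    and so all pairs that agree on the finite subset of [D] which determines
    this open set.  Compactness, applied along the directed family of finite
    subsets of [D], makes the finite set uniform. *)
Lemma agreement_entourage W : diag_nbhs (type_space M V) W ->
  exists S, [/\ finite_set S, S `<=` D & forall p q, agree S p q -> W (p, q)].
Proof.
move=> dW.
pose finite_in_D (S : set (formula L M V)) := finite_set S /\ S `<=` D.
pose F := filter_from finite_in_D (fun S => [set S' | S `<=` S']).
have FF : Filter F.
  apply: filter_from_filter.
    by exists set0; split=> //; exact: finite_set0.
  move=> A B [finA AD] [finB BD]; exists (A `|` B).
    by split; [rewrite finite_setU|rewrite subUset].
  by move=> S /=; rewrite subUset.
have := @type_space_compact L M V; rewrite compact_near_coveringP.
move=> /(_ _ F (fun S p => forall q, agree S p q -> W (p, q)) FF) [].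
  move=> p _.
  have [[A B] /= [/nbhs_typeP[a [pa aA]] /nbhs_typeP[b [pb bB]]] AB] := dW p.
  have [S [finS SD detS]] := D_determines (fand a b).
  exists ([set q : type_space M V | q (fand a b)], [set S' | S `<=` S']).
    by split; [apply: nbhs_type; apply/type_and|exists S].
  move=> [q S'] /= [qab SS'] r S'qr.
  have rab : r (fand a b).
    by apply: (determined_agree finS detS) qab => d /SS'; exact: S'qr.
  move: qab rab => /type_and[qa _] /type_and[_ rb].
  by apply: (AB (q, r)); split; [exact: aA|exact: bB].
move=> S [finS SD] SW; exists S; split=> // p q.
exact: SW (@subset_refl _ S) p I q.
Qed.

(** If [y] is on the boundary of no [[set p | f p d]] with [d] in a finite set
    [S], then near [y] all values of [f] agree on [S] with [f y]. *)
Lemma chain_osc_finite (f : type_space M V -> type_space M V) W :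
  ellis (type_system M V) f -> diag_nbhs (type_space M V) W ->
  finite_set (osc_deriv f W setT).
Proof.
move=> fE /agreement_entourage [S [finS SD SW]].
pose U d := [set p | f p d].
apply: (@sub_finite_set _ _ (\bigcup_(d in S) (closure (U d) `&`
                                               closure (~` U d)))); last first.
  apply: bigcup_finite => // d /SD Dd; apply: boundary_final_finite.
  exact: ellis_final.
move=> y [_ yosc]; apply: contrapT => ybd.
have nbhs_setC (A : set (type_space M V)) : ~ closure A y -> nbhs y (~` A).
  by move=> nA; have : (~` closure A) y by []; rewrite -interiorC.
have locally_const d : S d -> nbhs y [set v | f v d <-> f y d].
  move=> Sd; have /not_andP[] : ~ (closure (U d) y /\ closure (~` U d) y).
  - by move=> ybdd; apply: ybd; exists d.
  - move=> /nbhs_setC nU; have /= ny := nbhs_singleton nU.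
    by apply: filterS nU => v /= nv; split.
  - move=> /nbhs_setC; rewrite setCK => nU; have /= ny := nbhs_singleton nU.
    by apply: filterS nU => v /= nv; split.
have := filter_bigcap_finite finS (nbhs_filter y) locally_const.
rewrite nbhsE => -[V0 [oV Vy] VS].
have [v1 [v2 [[/VS v1S _] [/VS v2S _]]]] := yosc _ oV Vy.
apply; apply: SW => d Sd.
exact: iff_trans (v1S d Sd) (iff_sym (v2S d Sd)).
Qed.

End Chain.

(** * Cuts in an o-minimal structure *)

Section Cuts.
Context (L : language) (lt : rel_symb L) (M : structure L).

(** Among the two halves of the cut at [a] only [~ x < a], and not [x < a],
    is a final segment, like [a < x]; this makes the solution sets a chain. *)
Definition gt_formula (a : M) : formula L M unit :=
  Defs.frel (fun i : 'I_(rel_arity lt) =>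
    if nat_of_ord i is 0 then tcst L unit a else tvar L M tt).

Definition ge_formula (a : M) : formula L M unit :=
  fnot (Defs.frel (fun i : 'I_(rel_arity lt) =>
    if nat_of_ord i is 0 then tvar L M tt else tcst L unit a)).

Definition cuts : set (formula L M unit) :=
  range gt_formula `|` range ge_formula.

Lemma sat_gt a v : satM v (gt_formula a) <-> rel2 lt a (v tt).
Proof.
suff -> : rel2 lt a (v tt) = satM v (gt_formula a) by [].
by congr rel_interp; apply/funext => i; case: (nat_of_ord i).
Qed.

Lemma sat_ge a v : satM v (ge_formula a) <-> ~ rel2 lt (v tt) a.
Proof.
suff -> : (~ rel2 lt (v tt) a) = satM v (ge_formula a) by [].
by congr (~ _); congr rel_interp; apply/funext => i; case: (nat_of_ord i).
Qed.

Lemma cuts_aut (g : automorphism M) d : cuts d -> cuts (Defs.fmap g d).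
Proof.
move=> [] [a _ <-]; [left; exists (g a) => // | right; exists (g a) => //].
  by congr Defs.frel; apply/funext => i /=; case: (nat_of_ord i).
by congr fnot; congr Defs.frel; apply/funext => i /=; case: (nat_of_ord i).
Qed.

Hypothesis lt_linear : linear_order lt M.

Lemma cuts_chain c d : cuts c -> cuts d ->
  (forall v, satM v c -> satM v d) \/ (forall v, satM v d -> satM v c).
Proof.
have [irr trans tri] := lt_linear.
have upward e : cuts e -> forall v w, ~ rel2 lt (w tt) (v tt) ->
    satM v e -> satM w e.
  move=> [] [a _ <-] v w nwv.
    move=> /sat_gt av; apply/sat_gt.
    by case: (tri (v tt) (w tt)) => [/(trans _ _ _ av)|<-|/nwv].
  move=> /sat_ge nva; apply/sat_ge => wa; case: (tri (v tt) (w tt)).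
  - by move=> vw; apply: nva; exact: trans vw wa.
  - by move=> vw; apply: nva; rewrite vw.
  - exact: nwv.
move=> Cc Cd.
(* Of two final segments one contains the other: an element of the first that
   is not in the second bounds the second from below. *)
have [|] := pselect (forall v, satM v c -> satM v d).
  by left.
move=> /existsNP[v /not_implyP[vc nvd]]; right=> w wd.
apply: (upward _ Cc v w _ vc) => wv; apply: nvd.
apply: (upward _ Cd w v _ wd) => vw; apply: (irr (v tt)); exact: trans vw wv.
Qed.

Hypothesis definable_intervals : forall A : set M, definable A ->
  exists (P : set M) (J : set (option M * option M)),
    [/\ finite_set P, finite_set J
      & A = P `|` \bigcup_(I in J) interval lt I].

(** The formula defines a finite union of points and intervals; whether an
    element lies in it depends only on how the element compares with these
    points and with the endpoints of these intervals. *)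
Lemma cuts_determine (phi : formula L M unit) :
  exists S, [/\ finite_set S, S `<=` cuts & determined S phi].
Proof.
have [irr trans tri] := lt_linear.
have [|P [J [finP finJ phiE]]] :=
    definable_intervals (A := [set a | satM (fun=> a) phi]).
  by exists phi.
pose E : set M := P `|` \bigcup_(I in J)
  [set e | I.1 = Some e \/ I.2 = Some e].
have finE : finite_set E.
  rewrite finite_setU; split=> //; apply: bigcup_finite => // -[a b] _ /=.
  have fin_some (o : option M) : finite_set [set e | o = Some e].
    case: o => [e|].
      by apply: (sub_finite_set _ (finite_set1 e)) => e' [<-].
    by apply: (sub_finite_set _ (@finite_set0 M)).
  have := conj (fin_some a) (fin_some b).
  by rewrite -finite_setU.
exists (gt_formula @` E `|` ge_formula @` E); split.
- by rewrite finite_setU; split; exact: finite_image.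
- by move=> _ [] [e _ <-]; [left|right]; exists e.
move=> v w vw.
have gt_vw e : E e -> (rel2 lt e (v tt) <-> rel2 lt e (w tt)).
  move=> Ee; have S_e : (gt_formula @` E `|` ge_formula @` E) (gt_formula e).
    by left; exists e.
  exact: iff_trans (iff_sym (sat_gt e v)) (iff_trans (vw _ S_e) (sat_gt e w)).
have lt_vw e : E e -> (rel2 lt (v tt) e <-> rel2 lt (w tt) e).
  move=> Ee; have S_e : (gt_formula @` E `|` ge_formula @` E) (ge_formula e).
    by right; exists e.
  have := iff_trans (iff_sym (sat_ge e v)) (iff_trans (vw _ S_e) (sat_ge e w)).
  by move=> /iff_not2.
have satE (u : unit -> M) : satM u phi <->
    (P `|` \bigcup_(I in J) interval lt I) (u tt).
  rewrite -phiE /=; suff -> : u = (fun=> u tt) by [].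
  by apply/funext => -[].
move=> /satE [Pv|[[l r] Jlr [/= lv vr]]]; apply/satE.
  have Ev : E (v tt) by left.
  left; case: (tri (v tt) (w tt)) => [/(gt_vw _ Ev)/irr//|<-//|].
  by move=> /(lt_vw _ Ev)/irr.
right; exists (l, r) => //; split=> /=.
  case: l Jlr lv => // a Jlr; apply: (gt_vw a _).1.
  by right; exists (Some a, r) => //; left.
case: r Jlr vr => // b Jlr; apply: (lt_vw b _).1.
by right; exists (l, Some b) => //; right.
Qed.

End Cuts.

Theorem theorem3p5 (L : language) (lt : rel_symb L) (lt_binary : rel_arity lt = 2)
    (T : theory L) (T_omin : o_minimal lt T) (M : structure L) (MT : models M T) :
  (forall f : type_space M unit -> type_space M unit,
     ellis (type_system M unit) f ->
     (forall W : set (type_space M unit * type_space M unit),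
        diag_nbhs (type_space M unit) W ->
        finite_set (osc_iter f W [set: type_space M unit] (osucc ozero))) /\
     eord_le (beta f) (Some (osucc ozero))) /\
  eord_le (beta_system (type_system M unit)) (Some (osucc ozero)).
Proof.
have [lt_linear definableE] := T_omin M MT.
have fin f W : ellis (type_system M unit) f ->
    diag_nbhs (type_space M unit) W -> finite_set (osc_deriv f W setT).
  exact: (chain_osc_finite (cuts_chain lt_linear) (@cuts_aut _ lt M)
                           (cuts_determine lt_linear definableE)).
have beta1 f : ellis (type_system M unit) f ->
    eord_le (beta f) (Some (osucc ozero)).
  move=> fE; apply: beta_le1; first exact: type_space_hausdorff.
  by move=> W; exact: fin.
split; first by move=> f fE; split; [move=> W; exact: fin|exact: beta1].
by apply: (esupP _).2 => _ [f fE ->]; exact: beta1.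
Qed.
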